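(* Let $\Gamma=\langle U,V,W\rangle\le \mathrm{SL}_4(\mathbb Z)$ be the group generated by the three matrices $$U=\begin{pmatrix}1&1&1&2\\0&1&0&0\\0&0&1&0\\0&1&1&1\end{pmatrix},\quad V=\begin{pmatrix}1&0&0&0\\1&1&1&2\\0&0&1&0\\1&0&1&1\end{pmatrix},\quad W=\begin{pmatrix}1&0&0&0\\0&1&0&0\\1&1&1&2\\1&1&0&1\end{pmatrix},$$ and let $\gamma^+$ and $\gamma^-$ be the semigroups generated by $U,V,W$ and by $U^{-1},V^{-1},W^{-1}$, respectively. Then there is a six-element subgroup $\Omega<\Gamma$, isomorphic to the symmetric group $S_3$, such that every $g\in\Gamma$ can be written in the form $g=P\omega$ with $\omega\in\Omega$ and with either $P\in\gamma^+$ or $P\in\gamma^-$, where the word $P$ is also allowed to be empty (i.e. $P=I$). Moreover, $\gamma^+$ is a free semigroup on the generators $U,V,W$, and $\gamma^-$ is a free semigroup on the generators $U^{-1},V^{-1},W^{-1}$.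
   Context: A semigroup of matrices generated by a set $S$ consists of all finite products of elements of $S$. It is free on $S$ if two words in $S$ defining the same matrix are identical as words. *)

(* Defs.v *)
From HB Require Import structures.
From mathcomp Require Import all_boot all_algebra all_fingroup.
From mathcomp Require Import finmap.

Set Implicit Arguments.
Unset Strict Implicit.
Unset Printing Implicit Defensive.

Import GRing.Theory.

Section SpecialLinear.
Local Open Scope ring_scope.
Variables (R : comUnitRingType) (n : nat).

Record SL := MkSL { SLmx :> 'M[R]_n; SL_det : \det SLmx == 1 }.

HB.instance Definition _ := [isSub for SLmx].
HB.instance Definition _ := [Choice of SL by <:].

Implicit Types A B C : SL.

Fact SL_mul_subproof A B : \det (A *m B) == 1.
Proof. by rewrite det_mulmx (eqP (SL_det A)) (eqP (SL_det B)) mul1r. Qed.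

Fact SL_one_subproof : \det (1%:M : 'M[R]_n) == 1.
Proof. by rewrite det1. Qed.

Fact SL_inv_subproof A : \det (invmx A) == 1.
Proof. by rewrite det_inv (eqP (SL_det A)) invr1. Qed.

Definition SL_mul A B := MkSL (SL_mul_subproof A B).
Definition SL_one := MkSL SL_one_subproof.
Definition SL_inv A := MkSL (SL_inv_subproof A).

Fact SL_unitmx A : val A \in unitmx.
Proof. by rewrite unitmxE (eqP (SL_det A)) unitr1. Qed.

Fact SL_mulA : associative SL_mul.
Proof. by move=> A B C; apply: val_inj; rewrite /= mulmxA. Qed.

Fact SL_1mul : left_id SL_one SL_mul.
Proof. by move=> A; apply: val_inj; rewrite /= mul1mx. Qed.

Fact SL_mul1 : right_id SL_one SL_mul.
Proof. by move=> A; apply: val_inj; rewrite /= mulmx1. Qed.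

Fact SL_Vmul : left_inverse SL_one SL_inv SL_mul.
Proof. by move=> A; apply: val_inj; rewrite /= mulVmx ?SL_unitmx. Qed.

Fact SL_mulV : right_inverse SL_one SL_inv SL_mul.
Proof. by move=> A; apply: val_inj; rewrite /= mulmxV ?SL_unitmx. Qed.

HB.instance Definition _ :=
  isGroup.Build SL SL_mulA SL_1mul SL_mul1 SL_Vmul SL_mulV.

End SpecialLinear.

Section Generation.
Local Open Scope group_scope.
Variables (G : groupType) (S : {pred G}).

Inductive group_gen : G -> Prop :=
| group_gen_in x of x \in S : group_gen x
| group_gen1 : group_gen 1
| group_genM x y of group_gen x & group_gen y : group_gen (x * y)
| group_genV x of group_gen x : group_gen x^-1.

(* Words are nonempty, so that 1 belongs to the semigroup generated by S only *)
(* if it is the product of a nonempty word.                                   *)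
Definition is_word (w : seq G) := (w != [::]) && all [in S] w.

Definition semigroup_gen (x : G) :=
  exists2 w : seq G, is_word w & x = \prod_(y <- w) y.

Definition semigroup_free :=
  forall w1 w2 : seq G, is_word w1 -> is_word w2 ->
  \prod_(y <- w1) y = \prod_(y <- w2) y -> w1 = w2.

Definition is_proper_subgroup (H : G -> Prop) :=
  [/\ group_closed S, forall x, x \in S -> H x & exists2 x, H x & x \notin S].

End Generation.

Section Generators.
Local Open Scope ring_scope.

Definition mx4 (rows : seq (seq int)) : 'M[int]_4 :=
  \matrix_(i < 4, j < 4) (nth [::] rows i)`_j.

Definition Umx := mx4 [:: [:: 1; 1; 1; 2];
                          [:: 0; 1; 0; 0];
                          [:: 0; 0; 1; 0];
                          [:: 0; 1; 1; 1]].

Definition Vmx := mx4 [:: [:: 1; 0; 0; 0];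
                          [:: 1; 1; 1; 2];
                          [:: 0; 0; 1; 0];
                          [:: 1; 0; 1; 1]].

Definition Wmx := mx4 [:: [:: 1; 0; 0; 0];
                          [:: 0; 1; 0; 0];
                          [:: 1; 1; 1; 2];
                          [:: 1; 1; 0; 1]].

(* A computable Laplace expansion, to evaluate determinants by reduction. *)
Fixpoint laplace n (f : nat -> nat -> int) : int :=
  if n is n'.+1 then
    foldr +%R 0 [seq f 0%N k * ((-1) ^+ k *
                       laplace n' (fun i j => f i.+1 (bump k j))) | k <- iota 0 n]
  else 1.

Lemma laplaceE n (f : nat -> nat -> int) :
  \det (\matrix_(i < n, j < n) f i j) = laplace n f.
Proof.
elim: n f => [|n IHn] f; first by rewrite det_mx00.
rewrite (expand_det_row _ ord0) [RHS]/laplace -/laplace foldrE big_map.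
rewrite -[iota 0 n.+1]/(index_iota 0 n.+1) big_mkord.
apply: eq_bigr => k _; rewrite mxE /cofactor add0n -IHn.
congr (_ * (_ * \det _)).
by apply/matrixP => i j; rewrite !mxE.
Qed.

Lemma det_mx4 rows :
  \det (mx4 rows) = laplace 4 (fun i j => (nth [::] rows i)`_j).
Proof. exact: (@laplaceE 4 (fun i j => (nth [::] rows i)`_j)). Qed.

Fact U_det : \det Umx == 1.
Proof. by rewrite /Umx det_mx4; vm_compute. Qed.

Fact V_det : \det Vmx == 1.
Proof. by rewrite /Vmx det_mx4; vm_compute. Qed.

Fact W_det : \det Wmx == 1.
Proof. by rewrite /Wmx det_mx4; vm_compute. Qed.

Definition U : SL int 4 := MkSL U_det.
Definition V : SL int 4 := MkSL V_det.
Definition W : SL int 4 := MkSL W_det.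

End Generators.

Section Semigroups.
Local Open Scope group_scope.

Definition gens : seq (SL int 4) := [:: U; V; W].
Definition gensV : seq (SL int 4) := [:: U^-1; V^-1; W^-1].

Definition Gamma : SL int 4 -> Prop := group_gen [in gens].
Definition gamma_plus : SL int 4 -> Prop := semigroup_gen [in gens].
Definition gamma_minus : SL int 4 -> Prop := semigroup_gen [in gensV].

End Semigroups.

(* Main.v *)
Require Import Defs.
From HB Require Import structures.
From mathcomp Require Import all_boot all_order all_algebra all_fingroup.
From mathcomp Require Import finmap.
Set Implicit Arguments.
Unset Strict Implicit.
Unset Printing Implicit Defensive.
Import Order.TTheory GRing.Theory Num.Theory.

(* [letter_mx i e] is the [i]-th generator, inverted when [e] is set. Signed  *)
(* permutation matrices [omega s] permute the generators by conjugation and   *)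
(* invert them when [s] is odd. As X_i X_j^-1 = X_j omega(i j) and X_i^-1 X_j *)
(* = X_j^-1 omega(i j) for i != j, any sign change in a word can be pushed to *)
(* the right end as a permutation, which gives the normal form; it also gives *)
(* omega(i j) = X_j^-1 X_i X_j^-1, so these matrices lie in Gamma. Freeness   *)
(* is a ping-pong argument: X_i maps a positive vector to one whose [i]-th    *)
(* coordinate is the strict maximum of the first three. For inverses, the     *)
(* fourth coordinate is taken negative instead.                               *)

Section Matrices.
Local Open Scope ring_scope.

(** Conjugation by diag(1,1,1,-1) inverts every generator, so one sign [e] treats both semigroups at
    once; the sign in the corner of [omega_mx s] gives determinant 1 and makes odd [s] exchange
    them. Normal forms contain 1 and are stable under left multiplication by letters
    ([normal_letterM]), hence exhaust [Gamma]. Freeness ([word_inj]) holds since the image of a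
    positive vector reveals the first letter of a word, which can then be cancelled. *)

Definition letter_mx (i : 'I_3) (e : bool) : 'M[int]_(3 + 1) :=
  block_mx (\matrix_(a, b) ((a == b) || (a == i))%:R)
           (\col_a ((-1) ^+ e * (a == i)%:R *+ 2))
           (\row_b ((-1) ^+ e * (b != i)%:R)) 1%:M.

Definition omega_mx (s : 'S_3) : 'M[int]_(3 + 1) :=
  block_mx (perm_mx s) 0 0 ((-1) ^+ s)%:M.

(** Left multiplication by [perm_mx s] moves row [i] to row [s^-1 i]; the corner sign changes the
    off-diagonal blocks, which are the ones carrying [e]. *)
Lemma omega_mx_letter s i e :
  omega_mx s *m letter_mx i e = letter_mx ((s^-1)%g i) (e (+) s) *m omega_mx s.
Proof.
rewrite !mulmx_block !mul0mx !mulmx0 !addr0 !add0r mulmx1 mul1mx.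
have colE m (A : 'M[int]_(m, 3)) : A *m perm_mx s = col_perm (s^-1)%g A.
  by rewrite col_permE invgK.
rewrite -!row_permE !colE mul_scalar_mx mul_mx_scalar.
have eqs a k : (s a == k) = (a == (s^-1)%g k).
  exact: can2_eq (permK s) (permKV s) a k.
congr block_mx; apply/matrixP => a b; rewrite !mxE.
- by rewrite !eqs.
- by rewrite eqs; case: e; case: (odd_perm s); case: eqP.
- by rewrite (inj_eq perm_inj); case: e; case: (odd_perm s); case: eqP.
Qed.

Lemma letter_mxV i e : letter_mx i e *m letter_mx i (~~ e) = 1%:M.
Proof.
rewrite mulmx_block [RHS](@scalar_mx_block _ 3 1).
congr block_mx; apply/matrixP => a b;
  rewrite !mxE !big_ord_recl !big_ord0 !mxE ?ord1.
all: case: i => [[|[|[|//]]] ?]; case: e => //.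
all: case: a => [[|[|[|//]]] ?] //; case: b => [[|[|[|//]]] ?] //.
Qed.

Lemma letter_mx_exchange i j e : i != j ->
  letter_mx i e *m letter_mx j (~~ e) = letter_mx j e *m omega_mx (tperm i j).
Proof.
move=> ij; rewrite !mulmx_block !mulmx0 !addr0 !add0r odd_tperm ij.
congr block_mx; apply/matrixP => a b;
  rewrite !mxE !big_ord_recl !big_ord0 !mxE ?ord1 ?permE /=.
all: case: i ij => [[|[|[|//]]] ?]; case: j => [[|[|[|//]]] ?] //= _.
all: case: e => //.
all: case: a => [[|[|[|//]]] ?] //; case: b => [[|[|[|//]]] ?] //.
Qed.

Lemma omega_mxM s t : omega_mx (s * t)%g = omega_mx s *m omega_mx t.
Proof.
rewrite mulmx_block !mul0mx !mulmx0 !addr0 !add0r -perm_mxM -scalar_mxM.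
by rewrite /omega_mx odd_permM signr_addb.
Qed.

Lemma omega_mx_inj : injective omega_mx.
Proof.
move=> s t /eq_block_mx[/matrixP st _ _ _]; apply/permP => a.
by move: (st a (s a)); rewrite !mxE eqxx; case: eqP.
Qed.

(** The entry 2 or -2 in the last column tells them apart; this makes [Omega] proper in [Gamma]. *)
Lemma letter_mx_neq_omega i e s : letter_mx i e != omega_mx s.
Proof.
apply/eqP => /eq_block_mx[_ /matrixP/(_ i 0)]; rewrite !mxE eqxx.
by case: e.
Qed.

(** * The cone for the ping-pong argument *)

Definition pos_cone (e : bool) :=
  [pred v : 'cV[int]_(3 + 1) |
    [forall a, 0 < v (lshift 1 a) 0]
    & 0 < (-1) ^+ e * v (rshift 3 0) 0].

Lemma letter_mx_top i e (v : 'cV_(3 + 1)) a :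
  (letter_mx i e *m v) (lshift 1 a) 0 =
  if a == i then \sum_b v (lshift 1 b) 0 + (-1) ^+ e * v (rshift 3 0) 0 *+ 2
  else v (lshift 1 a) 0.
Proof.
rewrite mxE big_split_ord big_ord1 /= block_mxEur mxE.
under eq_bigr do rewrite block_mxEul mxE.
case: eqP => _.
  by under eq_bigr do rewrite orbT mul1r; rewrite mulr1 mulrnAl.
rewrite mulr0 mul0rn mul0r addr0 (bigD1 a) //= eqxx mul1r big1 ?addr0 // => b.
by rewrite orbF eq_sym => /negPf ->; rewrite mul0r.
Qed.

(** Coordinate [i] becomes the sum of the first three plus twice the signed fourth, all positive,
    while coordinate [a] is unchanged. *)
Lemma letter_mx_argmax i e v a : v \in pos_cone e -> a != i ->
  (letter_mx i e *m v) (lshift 1 a) 0 < (letter_mx i e *m v) (lshift 1 i) 0.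
Proof.
case/andP => /forallP v_gt0 d_gt0 ai; rewrite !letter_mx_top (negPf ai) eqxx.
rewrite (bigD1 a) //= -addrA ltrDl ltr_wpDl ?mulrn_wgt0 //.
by apply: sumr_ge0 => b _; exact: ltW.
Qed.

Lemma letter_mx_pos_cone i e v :
  v \in pos_cone e -> letter_mx i e *m v \in pos_cone e.
Proof.
move=> ve; have /andP[/forallP v_gt0 d_gt0] := ve.
have ge0 a : a != i -> 0 < (letter_mx i e *m v) (lshift 1 a) 0.
  by move=> ai; rewrite letter_mx_top (negPf ai).
apply/andP; split.
  apply/forallP => a; have [->|/ge0 //] := eqVneq a i.
  have [b bi] : exists b : 'I_3, b != i.
    by case: i {ge0} => [[|k] ?]; [exists 1 | exists 0].
  exact: lt_trans (ge0 b bi) (letter_mx_argmax ve bi).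
(* The signed fourth coordinate only grows: the sign of the bottom row cancels against that of the
   cone. *)
rewrite mxE big_split_ord big_ord1 /= block_mxEdr mxE mul1r mulrDr.
rewrite ltr_wpDl // mulr_sumr sumr_ge0 // => b _.
rewrite block_mxEdl mxE !mulrA -expr2 sqrr_sign mul1r.
by rewrite mulr_ge0 ?ler0n ?ltW.
Qed.

End Matrices.

(** * The embedding of ['S_3] and the letters as elements of the group *)

Local Open Scope group_scope.

Fact omega_det s : (\det (omega_mx s) == 1)%R.
Proof. by rewrite det_ublock det_perm det_scalar1 -expr2 sqrr_sign. Qed.

Definition omega s : SL int 4 := MkSL (omega_det s).

Lemma omega_inj : injective omega.
Proof. by move=> s t [/omega_mx_inj]. Qed.

Fact omegaM : {morph omega : s t / s * t}.
Proof. by move=> s t; apply: val_inj; exact: omega_mxM. Qed.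

Fact omega1 : omega 1 = 1.
Proof.
apply: val_inj.
by rewrite [RHS](@scalar_mx_block _ 3 1) /= /omega_mx perm_mx1 odd_perm1.
Qed.

HB.instance Definition _ := isMultiplicative.Build 'S_3 (SL int 4) omega omegaM.
HB.instance Definition _ :=
  Multiplicative_isUMagmaMorphism.Build 'S_3 (SL int 4) omega omega1.

Definition letter (i : 'I_3) (e : bool) : SL int 4 :=
  let x := nth 1 gens i in if e then x^-1 else x.

Lemma val_letter_pos i : val (letter i false) = letter_mx i false.
Proof.
apply/matrixP => a b; rewrite /letter.
case: i => [[|[|[|//]]] ?]; rewrite /= !mxE.
all: case: (@splitP 3 1 a) => a' ->; rewrite mxE.
all: case: (@splitP 3 1 b) => b' ->; rewrite !mxE ?ord1.
all: case: a' => [[|[|[|//]]] ?] //; case: b' => [[|[|[|//]]] ?] //.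
Qed.

Lemma val_letter i e : val (letter i e) = letter_mx i e.
Proof.
case: e; last exact: val_letter_pos.
rewrite -[LHS]mulmx1 -(letter_mxV i false) mulmxA -val_letter_pos /=.
by rewrite mulVmx ?mul1mx // SL_unitmx.
Qed.

Lemma letterV i e : (letter i e)^-1 = letter i (~~ e).
Proof. by case: e; rewrite /letter /= ?invgK. Qed.

Lemma val_SLM (A B : SL int 4) : val (A * B) = (val A *m val B)%R.
Proof. by []. Qed.

Lemma letter_exchange i j e : i != j ->
  letter i e * letter j (~~ e) = letter j e * omega (tperm i j).
Proof.
move=> ij; apply: val_inj.
by rewrite !val_SLM !val_letter letter_mx_exchange.
Qed.

Lemma omega_letter s i e :
  omega s * letter i e = letter (s^-1 i) (e (+) s) * omega s.
Proof. by apply: val_inj; rewrite !val_SLM !val_letter omega_mx_letter. Qed.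

(** * Normal forms *)

Definition word (e : bool) (u : seq 'I_3) : SL int 4 :=
  \prod_(i <- u) letter i e.

Lemma word_cons e i u : word e (i :: u) = letter i e * word e u.
Proof. exact: big_cons. Qed.

Lemma omega_word s e u :
  omega s * word e u = word (e (+) s) (map s^-1 u) * omega s.
Proof.
elim: u => [|i u IHu]; first by rewrite /word /= !big_nil mul1g mulg1.
by rewrite /= !word_cons mulgA omega_letter -mulgA IHu mulgA.
Qed.

Definition normal g := exists e u s, g = word e u * omega s.

Lemma normal1 : normal 1.
Proof.
by exists false, [::], 1; rewrite omega1 mulg1 /word big_nil.
Qed.

Lemma normal_letterM i e g : normal g -> normal (letter i e * g).
Proof.
case=> e' [[|j u] [s ->]].
  by exists e, [:: i], s; rewrite mulgA /word !big_nil mulg1 big_seq1.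
have [<-|ee'] := eqVneq e e'.
  by exists e, [:: i, j & u], s; rewrite !word_cons !mulgA.
have {e' ee'} -> : e' = ~~ e by case: e e' ee' => [] [].
have [->|ij] := eqVneq i j.
  by exists (~~ e), u, s; rewrite word_cons -letterV !mulgA mulgV mul1g.
(* The odd transposition produced by the exchange turns the whole tail to sign [e] on its way to the
   right. *)
exists e, (j :: map (tperm i j)^-1 u), (tperm i j * s).
rewrite !word_cons !mulgA letter_exchange // -[X in X * _]mulgA omega_word.
by rewrite odd_tperm ij addbT negbK omegaM !mulgA.
Qed.

Definition signed_gens e := if e then gensV else gens.

Lemma signed_gensP e x : x \in signed_gens e <-> exists i, x = letter i e.
Proof.
split.
  by case: e; rewrite !inE => /or3P[] /eqP ->;
    [exists 0%R|exists 1%R|exists (inord 2)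
    |exists 0%R|exists 1%R|exists (inord 2)];
    rewrite /letter ?inordK.
by case=> [[[|[|[|//]]] ?]] ->; case: e; rewrite !inE eqxx ?orbT.
Qed.

Lemma normal_Gamma g : Gamma g -> normal g.
Proof.
(* Treating [x] and [x^-1] together lets the induction pass through inverses. *)
suff norm x : Gamma x ->
    forall h, normal h -> normal (x * h) /\ normal (x^-1 * h).
  by move=> /norm/(_ 1 normal1)[]; rewrite mulg1.
elim=> [{}x /(signed_gensP false)[i ->] h nh
      ||{}x y _ IHx _ IHy h nh|{}x _ IHx h nh].
- by rewrite letterV; split; exact: normal_letterM.
- by move=> h; rewrite invg1 mul1g.
- split; first by rewrite -mulgA; apply: (IHx _ _).1; exact: (IHy _ nh).1.
  by rewrite invMg -mulgA; apply: (IHy _ _).2; exact: (IHx _ nh).2.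
- by rewrite invgK; have [] := IHx h nh.
Qed.

Lemma Gamma_letter i e : Gamma (letter i e).
Proof.
case: e; rewrite -?[letter i true]letterV; last first.
  by apply/group_gen_in/(signed_gensP false); exists i.
rewrite -[true]/(~~ false) -letterV; apply: group_genV.
by apply/group_gen_in/(signed_gensP false); exists i.
Qed.

Lemma Gamma_omega s : Gamma (omega s).
Proof.
have [ts -> /allP tsP] := prod_tpermP s.
rewrite (big_morph omega omegaM omega1) big_seq.
apply: big_ind => [||t /tsP tP].
- exact: group_gen1.
- exact: group_genM.
(* Transpositions generate ['S_3], and the exchange relation solved for [omega] expresses each one
   in letters. *)
have -> : omega (tperm t.1 t.2) =
    letter t.2 true * (letter t.1 false * letter t.2 true).
  rewrite (@letter_exchange _ _ false) // mulgA -[true]/(~~ false) -letterV.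
  by rewrite mulVg mul1g.
by do ?apply: group_genM; exact: Gamma_letter.
Qed.

(** * Freeness by ping-pong *)

Section Freeness.
Local Open Scope ring_scope.

Lemma word_pos_cone e u v :
  v \in pos_cone e -> val (word e u) *m v \in pos_cone e.
Proof.
move=> ve; elim: u => [|i u IHu]; first by rewrite /word big_nil mul1mx.
by rewrite word_cons val_SLM -mulmxA val_letter; exact: letter_mx_pos_cone.
Qed.

Lemma word_inj e : injective (word e).
Proof.
(* The empty word is recognized by the first three coordinates of [v] being   *)
(* equal.                                                                     *)
pose v : 'cV[int]_(3 + 1) := col_mx (const_mx 1) (const_mx ((-1) ^+ e)).
have vE a : v (lshift 1 a) 0 = 1 by rewrite col_mxEu mxE.
have ve : v \in pos_cone e.
  apply/andP; split; first by apply/forallP => a; rewrite vE.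
  by rewrite col_mxEd mxE -expr2 sqrr_sign.
have argmax i u a : a != i ->
    (val (word e (i :: u)) *m v) (lshift 1 a) 0 <
    (val (word e (i :: u)) *m v) (lshift 1 i) 0.
  rewrite word_cons val_SLM -mulmxA val_letter; apply: letter_mx_argmax.
  exact: word_pos_cone.
have neq1 i u : word e (i :: u) <> word e [::].
  have [a ai] : exists a : 'I_3, a != i.
    by case: i => [[|k] ?]; [exists 1 | exists 0].
  move=> wE; have := argmax i u a ai.
  by rewrite wE /word big_nil mul1mx !vE ltxx.
elim=> [|i u IHu] [|j w] // wE.
- by case: (neq1 j w).
- by case: (neq1 i u).
(* Otherwise coordinates [i] and [j] of the same vector would each be strictly larger than the
   other. *)
have ij : i = j.
  apply/eqP/negPn/negP => ij; have := argmax j w i ij; rewrite -wE => /lt_trans.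
  by move/(_ _ (argmax i u j _)); rewrite eq_sym ltxx => /(_ ij).
rewrite ij !word_cons in wE *; congr cons.
by apply: IHu; apply: mulgI wE.
Qed.

End Freeness.

(** * Transfer to the semigroups and conclusion *)

Lemma word_semigroup e u :
  u != [::] -> semigroup_gen [in signed_gens e] (word e u).
Proof.
move=> u0; exists (map (letter^~ e) u); last by rewrite big_map.
rewrite /is_word -size_eq0 size_map size_eq0 u0; apply/allP => x /mapP[i _ ->].
by apply/signed_gensP; exists i.
Qed.

Lemma signed_gens_free e : semigroup_free [in signed_gens e].
Proof.
have mapP w : all [in signed_gens e] w -> exists u, w = map (letter^~ e) u.
  elim: w => [|x w IHw] /=; first by exists [::].
  by case/andP=> /signed_gensP[i ->] /IHw[u ->]; exists (i :: u).
move=> w1 w2 /andP[_ /mapP[u1 ->]] /andP[_ /mapP[u2 ->]].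
by rewrite !big_map => /word_inj ->.
Qed.

Theorem theorem1 :
  (exists Omega : {fset SL int 4},
     [/\ is_proper_subgroup [in Omega] Gamma,
         #|` Omega| = 6,
         exists f : {multiplicative 'S_3 -> SL int 4},
           injective f /\ (forall w, w \in Omega <-> exists s : 'S_3, w = f s)
       & forall g, Gamma g ->
           exists P w, [/\ w \in Omega,
                           [\/ P = 1, gamma_plus P | gamma_minus P]
                         & g = P * w]]) /\
  semigroup_free [in gens] /\
  semigroup_free [in gensV].
Proof.
split; last first.
  by split; [exact: (@signed_gens_free false) | exact: (@signed_gens_free true)].
exists [fset omega s | s in 'S_3]%fset.
have OmegaP w :
    w \in [fset omega s | s in 'S_3]%fset <-> exists s : 'S_3, w = omega s.
  split=> [/imfsetP[s _ ->]|[s ->]]; first by exists s.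
  by apply/imfsetP; exists s.
split.
- split.
  + split; first by apply/OmegaP; exists 1; rewrite omega1.
    move=> x y /OmegaP[s ->] /OmegaP[t ->]; apply/OmegaP.
    by exists (s * t^-1); rewrite omegaM (gmulfV omega).
  + by move=> x /OmegaP[s ->]; exact: Gamma_omega.
  exists (letter 0%R false); first exact: Gamma_letter.
  apply/negP => /OmegaP[s /(congr1 val)]; rewrite val_letter => /eqP.
  by rewrite (negPf (letter_mx_neq_omega _ _ _)).
- rewrite card_imfset /=; last exact: omega_inj.
  by rewrite -cardE card_Sn.
- by exists omega; split; [exact: omega_inj | exact: OmegaP].
move=> g /normal_Gamma[e [u [s ->]]]; exists (word e u), (omega s); split=> //.
  by apply/OmegaP; exists s.
(* [semigroup_gen] takes nonempty words, so the empty word gives the case [P = 1]. *)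
have [->|u0] := eqVneq u [::]; first by apply: Or31; rewrite /word big_nil.
by case: e; [apply: Or33; exact: (@word_semigroup true)
           | apply: Or32; exact: (@word_semigroup false)].
Qed.
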